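(* Let $K$ be a field, and let $G_1$ and $G_2$ be finite simple graphs on the vertex sets $[m]$ and $[n]$, respectively. Let $T_1\subset V(G_1)$ and $T_2\subset V(G_2)$, and let $C_{11},\ldots,C_{1r}$ and $C_{21},\ldots,C_{2s}$ be those connected components of $(G_1)_{T_1}$ and $(G_2)_{T_2}$, respectively, which contain as an induced subgraph a line graph of length at least $2$. Then $\operatorname{nilpot}(J_{G_1,G_2})\geq rs+1$.
   Context: $[m]=\{1,\ldots,m\}$. $X=(x_{ij})$ is an $m\times n$ matrix of indeterminates, $K[X]$ the polynomial ring in its entries. For $e=\{i,j\}$ with $1\le i<j\le m$ and $f=\{k,l\}$ with $1\le k<l\le n$ put $p_{e,f}=x_{ik}x_{jl}-x_{il}x_{jk}$, and $J_{G_1,G_2}=(p_{e,f}: e\in E(G_1), f\in E(G_2))\subset K[X]$. For a graph $G$ and $T\subset V(G)$, $G_T$ denotes the induced subgraph (restriction) on $T$. A line graph of length $\ell$ is a path with $\ell$ edges. For an ideal $I$ in a Noetherian ring, the index of nilpotency $\operatorname{nilpot}(I)$ is the minimal integer $k$ such that $(\sqrt{I})^k\subset I$. *)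

(* Defs.v *)
From mathcomp Require Import all_boot all_order all_algebra.
From mathcomp Require Import mpoly.
From mathcomp Require Import boolp classical_sets.

Set Implicit Arguments.
Unset Strict Implicit.
Unset Printing Implicit Defensive.

Import GRing.Theory.
Local Open Scope ring_scope.

Record sgraph (V : Type) := SGraph {
  adj :> rel V;
  adj_sym : ssrbool.symmetric adj;
  adj_irr : irreflexive adj }.

Definition induced (V : finType) (G : sgraph V) (T : {set V}) :
    sgraph {x : V | x \in T} :=
  SGraph (adj := fun x y => G (val x) (val y))
    (fun x y => adj_sym G (val x) (val y)) (fun x => adj_irr G (val x)).

(* Vertex sets; the component itself is the graph induced on such a set. *)
Definition components (V : finType) (G : sgraph V) : {set {set V}} :=
  equivalence_partition (connect G) [set: V]%SET.

Definition line_adj (l : nat) : rel 'I_l.+1 :=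
  fun i j => (i.+1 == j :> nat) || (j.+1 == i :> nat).

Lemma line_adj_sym l : ssrbool.symmetric (@line_adj l).
Proof. by move=> i j; rewrite /line_adj orbC. Qed.

Lemma line_adj_irr l : irreflexive (@line_adj l).
Proof. by move=> i; rewrite /line_adj orbb gtn_eqF. Qed.

(* The length counts edges, so there are l.+1 vertices. *)
Definition line_graph (l : nat) : sgraph 'I_l.+1 :=
  SGraph (@line_adj_sym l) (@line_adj_irr l).

Definition contains_induced (W V : Type) (H : sgraph W) (G : sgraph V) : Prop :=
  exists f : W -> V, injective f /\ forall x y, G (f x) (f y) = H x y.

Definition long_components (V : finType) (G : sgraph V) : {set {set V}} :=
  [set C in components G |
     `[< exists l, (2 <= l)%N /\
           contains_induced (line_graph l) (induced G C) >]]%SET.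

Section Ideals.
Variable R : comNzRingType.
Implicit Types S I : set R.

Definition ideal_gen S : set R :=
  [set x | exists (d : nat) (a g : 'I_d -> R),
     (forall i, S (g i)) /\ x = \sum_(i < d) a i * g i]%classic.

Definition radical I : set R := [set x | exists k : nat, I (x ^+ k)]%classic.

Definition ideal_pow I (k : nat) : set R :=
  ideal_gen [set x | exists a : 'I_k -> R,
     (forall i, I (a i)) /\ x = \prod_(i < k) a i]%classic.

(* When no such k exists, which does not happen in a Noetherian ring, the value
   is 0. *)
Definition nilpot I : nat :=
  xget 0%N [set k | (ideal_pow (radical I) k `<=` I)%classic /\
     forall k', (ideal_pow (radical I) k' `<=` I)%classic -> (k <= k')%N]%classic.

End Ideals.

Section BinomialEdgeIdeal.
Variables (K : fieldType) (m n : nat).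

Definition varmx : 'M[{mpoly K[m * n]}]_(m, n) :=
  \matrix_(i, j) 'X_(mxvec_index i j).

Definition minor2 (i j : 'I_m) (k l : 'I_n) : {mpoly K[m * n]} :=
  varmx i k * varmx j l - varmx i l * varmx j k.

Definition pair_ideal (G1 : sgraph 'I_m) (G2 : sgraph 'I_n) :
    set {mpoly K[m * n]} :=
  ideal_gen [set p | exists (i j : 'I_m) (k l : 'I_n),
     [/\ (i < j)%N, G1 i j, (k < l)%N, G2 k l & p = minor2 i j k l]]%classic.

End BinomialEdgeIdeal.

Arguments pair_ideal K {m n} G1 G2 _.

(* Main.v *)
Require Import Defs.
From mathcomp Require Import all_boot all_order all_algebra.
From mathcomp Require Import mpoly ring zify.
From mathcomp Require Import boolp classical_sets.

(** Choosing in each long component an induced path with two edges reduces the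
    problem to [r * s] disjoint 3 x 3 blocks of variables. On a block
    [a b c / d e f / g h i] the binomial [u = e (a i - c g)] satisfies
    [u ^ 2 \in J], because
      [e^2 (a i - c g) = e i (a e - b d) + b d (e i - f h)
                         + d h (b f - c e) + c e (d h - e g)].
    So the product of the [r * s] binomials [u] lies in [(sqrt J) ^ (r s)]. It is
    not in [J]: call a monomial good if it involves only variables of the blocks
    and restricts on each block to one of [aei], [bdi], [afh]. Good monomials are
    closed under [x_ik x_jl -> x_il x_jk] along edges of both graphs, so summing
    the coefficients of good monomials is a linear form vanishing on [J], whereas
    it takes the value [1] on the product. Finally, [nilpot J] is a genuine minimum
    because [K[X]] is Noetherian, which is proved by Dickson's lemma on leading
    monomials. *)

Set Implicit Arguments.
Unset Strict Implicit.
Unset Printing Implicit Defensive.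

Import GRing.Theory Order.TTheory.
Local Open Scope ring_scope.

(** * Ideals, radicals and nilpotency *)

Section IdealTheory.
Variable R : comNzRingType.
Implicit Types (S I J : set R) (L : seq R).

Definition is_ideal I : Prop :=
  [/\ I 0, forall x y, I x -> I y -> I (x + y) & forall a x, I x -> I (a * x)].

Lemma ideal_sum I (T : Type) (r : seq T) (P : pred T) (F : T -> R) :
  is_ideal I -> (forall i, P i -> I (F i)) -> I (\sum_(i <- r | P i) F i).
Proof. by case=> I0 ID _ IF; elim/big_ind: _. Qed.

Lemma ideal_gen_is_ideal S : is_ideal (ideal_gen S).
Proof.
split.
- by exists 0%N, (fun=> 0), (fun=> 0); split=> [[]|] //; rewrite big_ord0.
- move=> x y [d [a [g [Sg ->]]]] [d' [a' [g' [Sg' ->]]]].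
  pose glue (u : 'I_d -> R) (v : 'I_d' -> R) i :=
    match fintype.split i with inl j => u j | inr j => v j end.
  exists (d + d')%N, (glue a a'), (glue g g'); split.
    by move=> i; rewrite /glue; case: fintype.split.
  by rewrite big_split_ord; congr (_ + _); apply: eq_bigr => i _;
     rewrite /glue (unsplitK (inl i), unsplitK (inr i)).
- move=> b x [d [a [g [Sg ->]]]]; exists d, (fun i => b * a i), g; split=> //.
  by rewrite mulr_sumr; apply: eq_bigr => i _; rewrite mulrA.
Qed.

Lemma ideal_gen_sub S : (S `<=` ideal_gen S)%classic.
Proof.
move=> x Sx; exists 1%N, (fun=> 1), (fun=> x); split=> //.
by rewrite big_ord1 mul1r.
Qed.

Lemma ideal_gen_min S I :
  is_ideal I -> (S `<=` I)%classic -> (ideal_gen S `<=` I)%classic.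
Proof.
move=> idI SI _ [d [a [g [Sg ->]]]]; apply: ideal_sum => // i _.
by case: idI => _ _; apply; apply/SI.
Qed.

(** Collecting equal generators makes the number of terms depend on [L] only, as the pigeonhole
    argument below requires. *)
Lemma ideal_gen_seqP L x : ideal_gen [set` L]%classic x ->
  exists c : nat -> R, x = \sum_(i < size L) c i * L`_i.
Proof.
move: x; apply: ideal_gen_min => [|g /= gL]; first split.
- by exists (fun=> 0); rewrite big1 // => i _; rewrite mul0r.
- move=> _ _ [c ->] [c' ->]; exists (fun i => c i + c' i).
  by rewrite -big_split /=; apply: eq_bigr => i _; rewrite mulrDl.
- move=> b _ [c ->]; exists (fun i => b * c i).
  by rewrite mulr_sumr; apply: eq_bigr => i _; rewrite mulrA.
- have gs : (index g L < size L)%N by rewrite index_mem.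
  exists (fun i => (i == index g L)%:R).
  rewrite (bigD1 (Ordinal gs)) //= eqxx mul1r nth_index // big1 ?addr0 // => i.
  by rewrite -val_eqE /= => /negPf->; rewrite mul0r.
Qed.

Lemma ideal_expr_le I x d e : is_ideal I -> (d <= e)%N -> I (x ^+ d) -> I (x ^+ e).
Proof. by move=> [_ _ IM] /subnK <-; rewrite exprD; apply: IM. Qed.

(* Pigeonhole: a product of more than [size L * e] generators repeats one of
   them more than [e] times. *)
Lemma prod_combinations_nilpotent J L : is_ideal J ->
    (forall g, g \in L -> radical J g) ->
  exists k, forall a : 'I_k -> R,
    (forall i, ideal_gen [set` L]%classic (a i)) -> J (\prod_i a i).
Proof.
move=> idJ radL.
have [e eP] : exists e, forall g, g \in L -> J (g ^+ e).
  elim: L radL => [|g L IH] radL; first by exists 0%N.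
  case: IH => [h hL|e eP]; first by apply: radL; rewrite inE hL orbT.
  have [d dP] := radL g (mem_head _ _).
  exists (maxn d e) => h; rewrite inE => /predU1P[->|hL].
    by apply: ideal_expr_le dP => //; apply: leq_maxl.
  by apply: ideal_expr_le (eP h hL) => //; apply: leq_maxr.
exists (size L * e).+1 => a aL.
have [c ac] := choice (fun i => ideal_gen_seqP (aL i)).
(* Each term of the expanded product is given by a function [f] that chooses one generator per
   factor. *)
rewrite (eq_bigr _ (fun i _ => ac i)) bigA_distr_bigA.
apply: ideal_sum => // f _; rewrite big_split /=; case: (idJ) => _ _; apply.
have [i fi] : exists i, (e < #|[pred j | f j == i]|)%N.
  apply/existsP; apply: contraT => /existsPn nf.
  have := card_ord (size L * e).+1; rewrite -sum1_card.
  rewrite (partition_big f xpredT) //= => sumE.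
  suff: ((size L * e).+1 <= size L * e)%N by rewrite ltnn.
  rewrite -[X in (X <= _)%N]sumE -[X in (_ <= X * _)%N]card_ord -sum_nat_const.
  by apply: leq_sum => i _; rewrite sum1_card leqNgt; apply: nf.
rewrite (bigID [pred j | f j == i]) /= mulrC; case: (idJ) => _ _; apply.
rewrite (eq_bigr (fun=> L`_i)) => [|j /eqP-> //]; rewrite prodr_const.
by apply: (ideal_expr_le idJ (ltnW fi)); apply: eP; apply: mem_nth.
Qed.

(** For sums, the pigeonhole lemma for [[:: x; y]] is applied with every factor equal to [x + y],
    replacing the binomial expansion. *)
Lemma radical_is_ideal J : is_ideal J -> is_ideal (radical J).
Proof.
move=> idJ; split=> [|x y Jx Jy|a x [k Jk]].
- by exists 1%N; rewrite expr1; case: idJ.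
- have [|k kP] := @prod_combinations_nilpotent J [:: x; y] idJ.
    by move=> g; rewrite !inE => /orP[]/eqP->.
  exists k; rewrite -[k in _ ^+ k]card_ord -prodr_const; apply: kP => _.
  case: (ideal_gen_is_ideal [set` [:: x; y]]%classic) => _ + _; apply;
    by apply: ideal_gen_sub => /=; rewrite !inE eqxx ?orbT.
- by exists k; rewrite exprMn; case: idJ => _ _; apply.
Qed.

End IdealTheory.

(** * Dickson's lemma *)

Section Dickson.

(** Each [phi i] minimises [u] on a tail that contains all later indices of the subsequence. *)
Lemma nondecreasing_subseq (u : nat -> nat) : exists phi : nat -> nat,
  {homo phi : i j / (i < j)%N} /\ {homo u \o phi : i j / (i <= j)%N}.
Proof.
have tail_min N : exists j, (N < j)%N /\ forall i, (N < i)%N -> (u j <= u i)%N.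
  have exv : exists v, `[< exists2 j, (N < j)%N & u j = v >].
    by exists (u N.+1); apply/asboolP; exists N.+1.
  case: (ex_minnP exv) => v /asboolP[j Nj <-] minv; exists j; split=> // i Ni.
  by apply: minv; apply/asboolP; exists i.
have [nxt nxtP] := choice tail_min.
pose phi i := iter i nxt (nxt 0%N).
have phiS i : phi i.+1 = nxt (phi i) by [].
have phi_nxt i : exists N, phi i = nxt N by case: i => [|i]; eexists.
have phi_lt : {homo phi : i j / (i < j)%N}.
  apply: homo_ltn => [y x z|i]; first exact: ltn_trans.
  by rewrite phiS; case: (nxtP (phi i)).
exists phi; split=> //; apply: homo_leq => [i|y x z|i /=].
- exact: leqnn.
- exact: leq_trans.
have [N ->] := phi_nxt i; apply: (proj2 (nxtP N)).
exact: ltn_trans (proj1 (nxtP N)) (proj1 (nxtP _)).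
Qed.

(** Extracting a subsequence once per variable makes all exponents nondecreasing; its first two
    terms then serve. *)
Lemma dickson n (u : nat -> 'X_{1..n}) :
  exists i j, (i < j)%N /\ (u i <= u j)%MM.
Proof.
suff [phi [phi_lt uphi]] : exists phi : nat -> nat,
    {homo phi : i j / (i < j)%N} /\
    forall c, c \in enum 'I_n -> {homo (fun i => u (phi i) c) : i j / (i <= j)%N}.
  exists (phi 0%N), (phi 1%N); split; first by apply: (phi_lt 0%N 1%N).
  by apply/mnm_lepP => c; apply: (uphi c (mem_enum _ c) 0%N 1%N).
elim: (enum _) => [|c s [phi [phi_lt uphi]]]; first by exists id; split=> ?.
have [psi [psi_lt upsi]] := nondecreasing_subseq (fun i => u (phi i) c).
exists (phi \o psi); split=> [i j ij|d]; first by apply/phi_lt/psi_lt.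
rewrite inE => /predU1P[-> //|ds] i j ij; apply: uphi => //.
by move: ij; rewrite leq_eqVlt => /predU1P[->|/psi_lt/ltnW].
Qed.

End Dickson.

(** * Hilbert's basis theorem and powers of the radical *)

Section HilbertBasis.
Variables (K : fieldType) (n : nat).
Implicit Types (p g : {mpoly K[n]}) (L : seq {mpoly K[n]}).

(** Division algorithm: subtracting the multiple [h] of [g] cancels the leading term of [p], and
    induction runs on leading monomials. *)
Lemma leading_terms_generate (I : set {mpoly K[n]}) L : is_ideal I ->
    (forall g, g \in L -> I g) ->
    (forall p, I p -> p != 0 ->
      exists g, [/\ g \in L, g != 0 & (mlead g <= mlead p)%MM]) ->
  (I `<=` ideal_gen [set` L])%classic.
Proof.
move=> [_ ID IM] LI lead_div; set J := ideal_gen _.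
have [J0 JD JM] : is_ideal J by apply: ideal_gen_is_ideal.
elim/mleadrect => p IH Ip; have [-> //|nzp] := eqVneq p 0.
have [g [gL nzg div_gp]] := lead_div p Ip nzp.
pose c := mleadc p / mleadc g; pose h := c *: 'X_[mlead p - mlead g] * g.
have Jh : J h by apply: JM; apply: ideal_gen_sub.
have nzc : c != 0 by rewrite mulf_neq0 ?invr_eq0 ?mleadc_eq0.
have nzX : 'X_[K, mlead p - mlead g] != 0.
  by rewrite -mleadc_eq0 mleadXm mcoeffX eqxx oner_eq0.
have nzcX : c *: 'X_[K, mlead p - mlead g] != 0 by rewrite scaler_eq0 negb_or nzc.
have lead_h : mlead h = mlead p by rewrite mleadM // mleadZ // mleadXm submK.
have leadc_h : h@_(mlead p) = mleadc p.
  rewrite -{1}lead_h [mlead h]mleadM // mleadcM mleadcZE mleadXm mcoeffX eqxx.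
  by rewrite mulr1 divfK // mleadc_eq0.
rewrite -[p](subrK h); apply: (JD) => //.
have [-> //|nzq] := eqVneq (p - h) 0; apply: IH; last first.
  by apply: ID => //; rewrite -mulN1r; apply/IM/IM/LI.
rewrite lt_neqAle; apply/andP; split.
  apply: contraNneq nzq => leadE.
  by rewrite -mleadc_eq0 leadE mcoeffB leadc_h subrr.
by apply: le_trans (mleadB_le _ _) _; rewrite lead_h joinxx.
Qed.

(** Otherwise, adjoining again and again an element whose leading monomial is divisible by no
    earlier one contradicts [dickson]. *)
Theorem hilbert_basis (I : set {mpoly K[n]}) : is_ideal I ->
  exists L, (forall g, g \in L -> I g) /\ (I `<=` ideal_gen [set` L])%classic.
Proof.
move=> idI; apply: contrapT => not_fg.
have new_lead L : exists p, (forall g, g \in L -> I g) ->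
    [/\ I p, p != 0 & forall g, g \in L -> g != 0 -> ~~ (mlead g <= mlead p)%MM].
  (* [choice] needs a value at every list; [0] is a dummy for lists not contained in [I]. *)
  have [LI|nLI] := pselect (forall g, g \in L -> I g); last by exists 0.
  apply: contrapT => no_p; apply: not_fg; exists L; split=> //.
  apply: leading_terms_generate => // p Ip nzp; apply: contrapT => no_g.
  apply: no_p; exists p => _; split=> // g gL nzg.
  by apply/negP => div_gp; apply: no_g; exists g.
have [next nextP] := choice new_lead.
pose Ls i := iter i (fun L => next L :: L) [::].
have LsI i g : g \in Ls i -> I g.
  elim: i g => //= i IH g; rewrite inE => /predU1P[->|/IH //].
  by have [] := nextP _ IH.
have Ls_next i j : (i < j)%N -> next (Ls i) \in Ls j.
  elim: j => // j IH; rewrite ltnS leq_eqVlt inE.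
  by case/predU1P=> [->|/IH ->]; rewrite ?eqxx ?orbT.
have [i [j [ij]]] := dickson (fun i => mlead (next (Ls i))).
have [_ nzi _] := nextP _ (LsI i); have [_ _ jP] := nextP _ (LsI j).
by apply/negP; apply: jP => //; apply: Ls_next.
Qed.

Lemma radical_nilpotent (J : set {mpoly K[n]}) : is_ideal J ->
  exists k, (ideal_pow (radical J) k `<=` J)%classic.
Proof.
move=> idJ; have [L [LJ JL]] := hilbert_basis (radical_is_ideal idJ).
have [k kP] := prod_combinations_nilpotent idJ LJ; exists k.
apply: ideal_gen_min => // _ [a [radJa ->]]; apply: kP => i.
by apply/JL/radJa.
Qed.

(* [N] lower-bounds [nilpot J] only because some [k] works: otherwise [nilpot]
   would take its default value [0]. *)
Lemma lt_nilpot (J : set {mpoly K[n]}) (N : nat) (a : 'I_N -> {mpoly K[n]}) :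
    is_ideal J -> (forall i, radical J (a i)) -> ~ J (\prod_i a i) ->
  (N < nilpot J)%N.
Proof.
move=> idJ rada prodNJ.
have powNJ k : (ideal_pow (radical J) k `<=` J)%classic -> (N < k)%N.
  move=> powJ; rewrite ltnNge; apply/negP => kN; apply: prodNJ.
  (* The first [k] factors give an element of the [k]-th power; the others form a multiplier. *)
  rewrite -(subnKC kN) in a rada *; rewrite big_split_ord /= mulrC.
  case: (idJ) => _ _; apply; apply: powJ; apply: ideal_gen_sub.
  by exists (fun i => a (lshift _ i)).
apply: powNJ; rewrite /nilpot.
set P := (X in xget _ X); suff [] : P (xget 0%N P) by [].
apply: xgetPex; have exk : exists k, `[< (ideal_pow (radical J) k `<=` J)%classic >].
  by have [k kP] := radical_nilpotent idJ; exists k; apply/asboolP.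
case: (ex_minnP exk) => k /asboolP kP mink; exists k; split=> // k' k'P.
by apply: mink; apply/asboolP.
Qed.

End HilbertBasis.

(** * Ideals of pairs of graphs *)

Section InducedPaths.

Notation v0 := (@Ordinal 3 0 isT).
Notation v1 := (@Ordinal 3 1 isT).
Notation v2 := (@Ordinal 3 2 isT).

Lemma ord3_cases (x : 'I_3) : [\/ x = v0, x = v1 | x = v2].
Proof.
by case: x => [[|[|[|]]] //= lt3];
  [apply: Or31 | apply: Or32 | apply: Or33]; apply: val_inj.
Qed.

(** The absence of edges between different paths is what keeps a move inside a single block. *)
Definition path_family (V : eqType) (G : sgraph V) r (P : 'I_r -> 'I_3 -> V) :=
  (forall a x b y, (P a x == P b y) = (a == b) && (x == y)) /\
  (forall a x b y, G (P a x) (P b y) = (a == b) && line_graph 2 x y).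

(* With the entries of a 3 x 3 block named [a b c / d e f / g h i], the exponent
   matrices satisfying this are those of [aei], [bdi] and [afh]. *)
Definition diag_fiber (q : 'I_3 -> 'I_3 -> nat) : bool :=
  [&& q v0 v0 + q v0 v1 + q v0 v2 == 1, q v1 v0 + q v1 v1 + q v1 v2 == 1,
      q v2 v0 + q v2 v1 + q v2 v2 == 1, q v0 v0 + q v1 v0 + q v2 v0 == 1,
      q v0 v1 + q v1 v1 + q v2 v1 == 1, q v0 v2 + q v1 v2 + q v2 v2 == 1,
      q v0 v2 == 0 & q v2 v0 == 0]%N.

(** Row and column sums do not change. A move creating the corner [c] would start from [b f], whose
    only completion to a permutation matrix uses the excluded corner [g]; exchanging [c] and [g] is
    symmetric. *)
Lemma diag_fiber_move (q : 'I_3 -> 'I_3 -> nat) (x y z t : 'I_3) :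
    line_graph 2 x y -> line_graph 2 z t ->
  diag_fiber (fun u v => q u v + ((x == u) && (z == v)) + ((y == u) && (t == v)))%N ->
  diag_fiber (fun u v => q u v + ((x == u) && (t == v)) + ((y == u) && (z == v)))%N.
Proof.
rewrite /diag_fiber.
case: (ord3_cases x) => ->; case: (ord3_cases y) => -> //;
  case: (ord3_cases z) => ->; case: (ord3_cases t) => -> // _ _;
  rewrite !eqE /=; lia.
Qed.

Variables (K : fieldType) (m n : nat) (G1 : sgraph 'I_m) (G2 : sgraph 'I_n).
Variables (r s : nat) (P : 'I_r -> 'I_3 -> 'I_m) (Q : 'I_s -> 'I_3 -> 'I_n).
Hypotheses (famP : path_family G1 P) (famQ : path_family G2 Q).

(** * Good monomials and the linear form *)

Implicit Types (w : 'X_{1..m * n}) (p q : {mpoly K[m * n]}).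

Definition var_mnm (i : 'I_m) (j : 'I_n) : 'X_{1..m * n} := U_(mxvec_index i j)%MM.

Definition expo w i j : nat := w (mxvec_index i j).

Lemma expoD w w' i j : expo (w + w')%MM i j = (expo w i j + expo w' i j)%N.
Proof. exact: mnmDE. Qed.

Lemma expo_var i j k l : expo (var_mnm i j) k l = ((i == k) && (j == l)).
Proof.
rewrite /expo /var_mnm mnm1E; congr nat_of_bool.
case: (curry_mxvec_bij m n) => g gK _.
apply/eqP/andP => [eq_ij|[/eqP-> /eqP-> //]].
have [] : (i, j) = (k, l) by rewrite -(gK (i, j)) // -[(k, l)]gK //= eq_ij.
by move=> -> ->.
Qed.

Lemma minor2E i j k l : @minor2 K m n i j k l =
  'X_[var_mnm i k + var_mnm j l] - 'X_[var_mnm i l + var_mnm j k].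
Proof. by rewrite /minor2 !mxE !mpolyXD. Qed.

Definition on_paths w : Prop := forall i j, expo w i j != 0%N ->
  (exists a x, i = P a x) /\ (exists b y, j = Q b y).

Definition good_mnm w : Prop := on_paths w /\
  forall a b, diag_fiber (fun x y => expo w (P a x) (Q b y)).

(** Since [on_paths] puts all four vertices on paths, each edge lies in one path. The move thus
    affects one block, where [diag_fiber_move] applies. *)
Lemma good_mnm_move w i j k l : G1 i j -> G2 k l ->
  good_mnm (w + (var_mnm i k + var_mnm j l))%MM ->
  good_mnm (w + (var_mnm i l + var_mnm j k))%MM.
Proof.
case: famP famQ => [Pinj Padj] [Qinj Qadj] Gij Gkl [onw fibw].
have [|[a [x iE]] [b [z kE]]] := onw i k.
  by rewrite !expoD !expo_var !eqxx addnS.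
have [|[a' [y jE]] [b' [t lE]]] := onw j l.
  by rewrite !expoD !expo_var !eqxx !addnS.
move: Gij Gkl; rewrite iE jE kE lE Padj Qadj.
case/andP=> /eqP aa' xy /andP[/eqP bb' zt].
subst; split=> [i j|c d].
  rewrite !expoD !expo_var => nz.
  have [] : [\/ expo w i j != 0%N, (i, j) = (P a' x, Q b' t)
             | (i, j) = (P a' y, Q b' z)].
    move: nz; case: (eqVneq (expo w i j) 0%N) => [->|]; last by constructor 1.
    case: andP => [[/eqP-> /eqP->] _|_]; first by constructor 2.
    case: andP => [[/eqP-> /eqP->] _|//]; by constructor 3.
  - by move=> nzw; apply: onw; rewrite expoD addn_eq0 (negPf nzw).
  - by case=> -> ->; split; eexists; eexists.
  - by case=> -> ->; split; eexists; eexists.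
have := fibw c d; have blockE u v u' v' :
  (fun x0 y0 => expo (w + (var_mnm (P a' u) (Q b' v) + var_mnm (P a' u') (Q b' v')))
     (P c x0) (Q d y0)) = (fun x0 y0 => expo w (P c x0) (Q d y0) +
     [&& a' == c, b' == d & (u == x0) && (v == y0)] +
     [&& a' == c, b' == d & (u' == x0) && (v' == y0)])%N.
  apply/funext => x0; apply/funext => y0.
  rewrite !expoD !expo_var !Pinj !Qinj addnA.
  by case: (a' == c); case: (b' == d); rewrite ?andbF.
rewrite !blockE; case: (a' == c); case: (b' == d) => //=.
exact: diag_fiber_move.
Qed.

(* Truncating at degree [d] makes the sum finite without restricting [p]. *)
Definition fiber_sum d p : K :=
  \sum_(w : bmultinom (m * n) d | `[< good_mnm w >]) p@_w.

Lemma fiber_sumB d : {morph fiber_sum d : p q / p - q}.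
Proof.
move=> p q; rewrite /fiber_sum -sumrB.
by apply: eq_bigr => w _; rewrite mcoeffB.
Qed.

Lemma fiber_sumD d : {morph fiber_sum d : p q / p + q}.
Proof.
move=> p q; rewrite /fiber_sum -big_split.
by apply: eq_bigr => w _; rewrite mcoeffD.
Qed.

Lemma fiber_sumZ d c p : fiber_sum d (c *: p) = c * fiber_sum d p.
Proof.
by rewrite /fiber_sum mulr_sumr; apply: eq_bigr => w _; rewrite mcoeffZ.
Qed.

Lemma fiber_sum0 d : fiber_sum d 0 = 0.
Proof. by rewrite /fiber_sum big1 // => w _; rewrite mcoeff0. Qed.

Lemma fiber_sumX d w :
  fiber_sum d 'X_[w] = ((mdeg w < d)%N && `[< good_mnm w >])%:R.
Proof.
rewrite /fiber_sum; have [wd|nwd] := boolP (mdeg w < d)%N; last first.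
  rewrite big1 // => v _; rewrite mcoeffX.
  by case: eqP => // wv; case/negP: nwd; rewrite wv; apply: bmdeg.
rewrite big_mkcond (bigD1 (BMultinom wd)) //= big1 ?addr0 => [|v].
  by rewrite mcoeffX eqxx; case: ifP.
rewrite -val_eqE /= mcoeffX eq_sym => /negPf->; exact: if_same.
Qed.

(* The largest ideal inside the kernel of [fiber_sum d]. *)
Definition fiber_ann d : set {mpoly K[m * n]} :=
  [set p | forall q, fiber_sum d (q * p) = 0]%classic.

Lemma fiber_ann_ideal d : is_ideal (fiber_ann d).
Proof.
split=> [q|p p' Ap Ap' q|a p Ap q]; first by rewrite mulr0 fiber_sum0.
  by rewrite mulrDr fiber_sumD Ap Ap' addr0.
by rewrite mulrA Ap.
Qed.

Lemma fiber_annP d p :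
  (forall w, fiber_sum d ('X_[w] * p) = 0) -> fiber_ann d p.
Proof.
move=> Xp q; rewrite [q]mpolyE mulr_suml.
elim/big_rec: _ => [|w y _ y0]; first exact: fiber_sum0.
by rewrite fiber_sumD y0 -scalerAl fiber_sumZ Xp mulr0 addr0.
Qed.

(** A monomial multiple of a generator is a difference of two monomials of equal degree, both good
    or both not. *)
Lemma pair_ideal_ann d : (pair_ideal K G1 G2 `<=` fiber_ann d)%classic.
Proof.
apply: ideal_gen_min; first exact: fiber_ann_ideal.
move=> _ [i [j [k [l [_ Gij _ Gkl ->]]]]]; apply: fiber_annP => w.
rewrite minor2E mulrBr -!mpolyXD fiber_sumB !fiber_sumX.
set u := (var_mnm i k + _)%MM; set v := (var_mnm i l + _)%MM.
have -> : mdeg (w + u) = mdeg (w + v) by rewrite !mdegD !mdeg1.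
suff -> : `[< good_mnm (w + u) >] = `[< good_mnm (w + v) >] by rewrite subrr.
(* The converse is the same move with [k] and [l] exchanged. *)
apply: asbool_equiv_eq; split; apply: good_mnm_move => //.
by rewrite adj_sym.
Qed.

Definition diag_mnm (t : 'I_r * 'I_s) : 'X_{1..m * n} :=
  (\sum_x var_mnm (P t.1 x) (Q t.2 x))%MM.

Definition antidiag_mnm (t : 'I_r * 'I_s) : 'X_{1..m * n} :=
  (\sum_x var_mnm (P t.1 x) (Q t.2 (rev_ord x)))%MM.

(* This is [e (a i - c g)] on the block [t]. *)
Definition block_binomial t : {mpoly K[m * n]} :=
  'X_[diag_mnm t] - 'X_[antidiag_mnm t].

(** Every monomial multiple has a positive exponent at the corner [c] of the block [t], so it is not
    good. *)
Lemma antidiag_ann d t : fiber_ann d 'X_[antidiag_mnm t].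
Proof.
apply: fiber_annP => w; rewrite -mpolyXD fiber_sumX andbC.
case: asboolP => // -[_ /(_ t.1 t.2) /and5P[_ _ _ _ /and4P[_ _]]].
rewrite expoD {2}/expo /antidiag_mnm mnm_sumE (bigD1 v0) //=.
have -> : rev_ord v0 = v2 by apply: val_inj.
by rewrite -/(expo _ _ _) expo_var !eqxx addn_eq0 andbF.
Qed.

Lemma expo_diag_sum a b x y :
  expo (\sum_t diag_mnm t)%MM (P a x) (Q b y) = (x == y).
Proof.
rewrite /expo mnm_sumE (bigD1 (a, b)) //= big1 => [|t tab]; last first.
  rewrite mnm_sumE big1 // => z _; rewrite -/(expo _ _ _) expo_var.
  rewrite (proj1 famP) (proj1 famQ); apply/eqP; rewrite eqb0.
  by apply: contra tab => /andP[/andP[? _] /andP[? _]]; rewrite -pair_eqE; apply/andP.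
rewrite addn0 mnm_sumE (bigD1 x) //= big1 => [|z zx]; last first.
  by rewrite -/(expo _ _ _) expo_var (proj1 famP) (negPf zx) andbF.
by rewrite -/(expo _ _ _) expo_var (proj1 famP) (proj1 famQ) !eqxx addn0.
Qed.

Lemma good_diag_sum : good_mnm (\sum_t diag_mnm t)%MM.
Proof.
split=> [i j|a b]; last by rewrite /diag_fiber !expo_diag_sum.
rewrite /expo mnm_sumE sum_nat_eq0 negb_forall => /existsP[[a b]] /=.
rewrite mnm_sumE sum_nat_eq0 negb_forall => /existsP[x] /=.
rewrite -/(expo _ _ _) expo_var eqb0 negbK => /andP[/eqP<- /eqP<-].
by split; [exists a, x | exists b, x].
Qed.

(** * The block binomials and their product *)

Lemma pair_ideal_is_ideal : is_ideal (pair_ideal K G1 G2).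
Proof. exact: ideal_gen_is_ideal. Qed.

(** Vertices along a path need not be numbered increasingly; reordering rows or columns only changes
    the sign of a minor. *)
Lemma minor2_in_ideal i j k l :
  G1 i j -> G2 k l -> pair_ideal K G1 G2 (@minor2 K m n i j k l).
Proof.
move=> Gij Gkl; have [_ _ JM] := pair_ideal_is_ideal.
have sign_minor (c : bool) p : pair_ideal K G1 G2 ((-1) ^+ c * p) ->
    pair_ideal K G1 G2 p.
  by move=> Jp; rewrite -[p](signrMK c); apply: JM.
have ne_lt N (H : sgraph 'I_N) (u v : 'I_N) : H u v -> (u < v)%N || (v < u)%N.
  by move=> Huv; rewrite -neq_ltn; apply: contraTneq Huv => /val_inj->; rewrite adj_irr.
case/orP: (ne_lt _ _ _ _ Gij) => ij; case/orP: (ne_lt _ _ _ _ Gkl) => kl.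
- by apply: ideal_gen_sub; exists i, j, k, l.
- apply: (sign_minor true); apply: ideal_gen_sub; exists i, j, l, k.
  by split=> //; [rewrite adj_sym | rewrite /minor2; ring].
- apply: (sign_minor true); apply: ideal_gen_sub; exists j, i, k, l.
  by split=> //; [rewrite adj_sym | rewrite /minor2; ring].
- apply: ideal_gen_sub; exists j, i, l, k.
  by split=> //; [rewrite adj_sym | rewrite adj_sym | rewrite /minor2; ring].
Qed.

Lemma block_binomial_radical t :
  radical (pair_ideal K G1 G2) (block_binomial t).
Proof.
case: t => a b; exists 2%N.
have [_ JD JM] := pair_ideal_is_ideal.
pose X x y : {mpoly K[m * n]} := varmx K m n (P a x) (Q b y).
pose M x y z t : {mpoly K[m * n]} := minor2 K (P a x) (P a y) (Q b z) (Q b t).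
have JMin x y z t : line_graph 2 x y -> line_graph 2 z t ->
    pair_ideal K G1 G2 (M x y z t).
  move=> xy zt; apply: minor2_in_ideal.
    by rewrite (proj2 famP) eqxx.
  by rewrite (proj2 famQ) eqxx.
have fE : block_binomial (a, b) = X v1 v1 * (X v0 v0 * X v2 v2 - X v0 v2 * X v2 v0).
  have sum3 (F : 'I_3 -> 'X_{1..m * n}) : (\sum_x F x = F v0 + F v1 + F v2)%MM.
    rewrite 3!big_ord_recr big_ord0 /= add0m.
    by congr (F _ + F _ + F _)%MM; apply: val_inj.
  have [r0 r1 r2] : [/\ rev_ord v0 = v2, rev_ord v1 = v1 & rev_ord v2 = v0].
    by split; apply: val_inj.
  rewrite /block_binomial /diag_mnm /antidiag_mnm !sum3 r0 r1 r2 !mpolyXD /X !mxE.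
  by rewrite /var_mnm; ring.
(* The second factor is [e^2 (a i - c g)]: it telescopes along the monomials [a e^2 i], [b d e i],
   [b d f h], [c d e h], [c e^2 g]. *)
have -> : block_binomial (a, b) ^+ 2 = (X v0 v0 * X v2 v2 - X v0 v2 * X v2 v0) *
   (X v1 v1 * X v2 v2 * M v0 v1 v0 v1 + X v0 v1 * X v1 v0 * M v1 v2 v1 v2
    + X v1 v0 * X v2 v1 * M v0 v1 v1 v2 + X v0 v2 * X v1 v1 * M v1 v2 v0 v1).
  by rewrite fE /M /minor2 -!/(X _ _); ring.
by apply: (JM); do !apply: (JD); apply: (JM); apply: JMin.
Qed.

Lemma prod_block_binomial_notin :
  ~ pair_ideal K G1 G2 (\prod_t block_binomial t).
Proof.
(* The successor is needed because [fiber_sum d] sees only degrees strictly below [d]. *)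
pose d := (mdeg (\sum_t diag_mnm t)).+1 => /(@pair_ideal_ann d) Aprod.
have [A0 AD AM] := fiber_ann_ideal d.
have AN p : fiber_ann d p -> fiber_ann d (- p) by rewrite -mulN1r; apply: AM.
(* Modulo the ideal [fiber_ann d], each binomial is congruent to its diagonal monomial. *)
have congr_prod : fiber_ann d
    (\prod_t block_binomial t - \prod_t 'X_[diag_mnm t]).
  elim/big_ind2: _ => [|p p' q q' Ap Aq|t _]; first by rewrite subrr.
    have -> : p' * q' - p * q = q' * (p' - p) + p * (q' - q) by ring.
    by apply: AD; apply: AM.
  by rewrite /block_binomial addrAC subrr add0r; apply: AN; apply: antidiag_ann.
have /(_ 1) : fiber_ann d (\prod_t 'X_[diag_mnm t]).
  by rewrite -[X in fiber_ann d X](subKr (\prod_t block_binomial t)); apply/AD/AN.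
rewrite mul1r -(big_morph _ (@mpolyXD _ K) (mpolyX0 _ K)) fiber_sumX ltnSn.
case: asboolP => [_ /eqP|]; first by rewrite oner_eq0.
by case; apply: good_diag_sum.
Qed.

End InducedPaths.

(** * Induced paths in the long components *)

Lemma components_connect (V : finType) (G : sgraph V) (C D : {set V}) x y :
  C \in components G -> D \in components G -> x \in C -> y \in D ->
  connect G x y = (C == D).
Proof.
have eqR : {in [set: V] & &, equivalence_rel (connect G)}.
  apply: in3W; apply/equivalence_relP; split=> [u|u v uv w].
    exact: connect0.
  exact: (same_connect (sym_connect_sym (adj_sym G)) uv).
have trivC := partition_trivIset (equivalence_partitionP eqR).
move=> CG DG xC yD.
rewrite -(pblock_equivalence_partition eqR) ?inE //.
rewrite (def_pblock trivC CG xC); apply/idP/eqP => [yC|-> //].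
by rewrite -(def_pblock trivC CG yC) (def_pblock trivC DG yD).
Qed.

Lemma long_component_path (V : finType) (G : sgraph V) (C : {set V}) :
    C \in long_components G ->
  C \in components G /\ exists p : 'I_3 -> V,
    [/\ injective p, forall x, p x \in C & forall x y, G (p x) (p y) = line_graph 2 x y].
Proof.
rewrite inE => /andP[compC /asboolP[l [l2 [f [f_inj fE]]]]]; split=> //.
have le3 : (3 <= l.+1)%N by [].
(* The first three vertices of the longer induced path. *)
exists (fun x => val (f (widen_ord le3 x))); split=> [x y|x|x y].
- by move=> /val_inj/f_inj /(congr1 val) xy; apply: val_inj.
- exact: valP.
- exact: fE.
Qed.

(** A common vertex or an edge between paths chosen in different components would connect these
    components. *)
Lemma long_components_path_family (V : finType) (G : sgraph V) (T : {set V}) :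
  exists P : 'I_#|long_components (induced G T)| -> 'I_3 -> V, path_family G P.
Proof.
have compP (a : 'I_#|long_components (induced G T)|) :=
  long_component_path (enum_valP a).
have [p pP] := choice (fun a => proj2 (compP a)).
have connE a b x y : connect (induced G T) (p a x) (p b y) = (a == b).
  rewrite (components_connect (proj1 (compP a)) (proj1 (compP b))); last 2 first.
  - by case: (pP a).
  - by case: (pP b).
  by rewrite (inj_eq enum_val_inj).
exists (fun a x => val (p a x)); split=> a x b y.
  rewrite (inj_eq val_inj); case: (eqVneq a b) => [<-|ab] /=.
    by rewrite (inj_eq (_ : injective (p a))) //; case: (pP a).
  by apply: contraNF ab => /eqP eqp; rewrite -(connE a b x y) eqp connect0.
case: (eqVneq a b) => [<-|ab] /=; first by case: (pP a) => _ _; apply.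
by apply: contraNF ab => adj_ab; rewrite -(connE a b x y); apply: connect1.
Qed.

Theorem theorem5p1 (K : fieldType) (m n : nat)
  (G1 : sgraph 'I_m) (G2 : sgraph 'I_n)
  (T1 : {set 'I_m}) (T2 : {set 'I_n}) (r s : nat)
  (hr : #|long_components (induced G1 T1)| = r)
  (hs : #|long_components (induced G2 T2)| = s) :
  (r * s + 1 <= nilpot (pair_ideal K G1 G2))%N.
Proof.
have [P famP] := long_components_path_family G1 T1.
have [Q famQ] := long_components_path_family G2 T2.
(* [lt_nilpot] takes a family indexed by an ordinal, so the product is written as the number of
   blocks, to be enumerated by [enum_val]. *)
rewrite -hr -hs -[X in (X * _)%N]card_ord -[X in (_ * X)%N]card_ord -card_prod addn1.
apply: (@lt_nilpot _ _ _ _ (fun i => block_binomial K P Q (enum_val i))).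
- exact: pair_ideal_is_ideal.
- by move=> i; apply: block_binomial_radical.
- by rewrite -big_enum_val (eq_bigl xpredT) //; apply: prod_block_binomial_notin.
Qed.
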